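(* Let $\Lambda$, $A$ and $B$ be closed subsets of $\mathbb{E}$, let $\bar x\in S\subset A\cap B\cap\Lambda$, and let $n\in\mathbb{N}$ with $n\ge1$ and $c\in[0,1)$ be fixed. Suppose that there is $\rho>0$ such that for any alternating projections sequence $(x_k)_{k\in\mathbb{N}}$ starting at a point $x_0\in A\cap\Lambda$ with $\|x_0-\bar x\|<\rho$, there exists a subsequence of the form $(x_{j+nk})_{k\in\mathbb{N}}$ for some $j\in\{0,1,\ldots,n-1\}$ that remains in $\Lambda$ and is linearly monotone with respect to $S$ with constant $c$. Then the collection of sets $\{A,B\}$ is subtransversal at $\bar x$ relative to $\Lambda$ with constant $$\mathrm{sr}'[A,B](\bar x)\le\frac{2\big(2n^2-1-c(n-1)\big)}{1-c}.$$
   Context: $\mathbb{E}$ is a Euclidean space; $\operatorname{dist}(x,C):=\inf_{a\in C}\|x-a\|$; $\mathbb{B}_\delta(x)$ is the open ball. The projector onto a closed set $C$ is the set-valued map $P_Cx:=\operatorname{argmin}_{a\in C}\|a-x\|$. Alternating projections: a sequence $(x_k)$ with $x_{k+1}\in P_AP_Bx_k$ for all $k\in\mathbb{N}$, i.e. there are $b_k\in P_Bx_k$ with $x_{k+1}\in P_Ab_k$. Starting points are always assumed to satisfy $x_0\in A$. Linear monotonicity: $(y_k)$ is linearly monotone with respect to a nonempty set $S$ with constant $c\in[0,1]$ if $\operatorname{dist}(y_{k+1},S)\le c\operatorname{dist}(y_k,S)$ for all $k$. Subtransversality (at a common point): $\{A,B\}$ is subtransversal at $\bar x\in A\cap B$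 relative to $\Lambda$ if there are $\delta>0$, $\kappa\ge0$ with $\operatorname{dist}(x,A\cap B\cap\Lambda)\le\kappa\max\{\operatorname{dist}(x,A),\operatorname{dist}(x,B)\}$ for all $x\in\mathbb{B}_\delta(\bar x)\cap\Lambda$. Equivalently, there are $\delta>0$, $\kappa\ge0$ with $$\operatorname{dist}(x,A\cap B\cap\Lambda)\le\kappa\operatorname{dist}(x,B)\quad\forall x\in A\cap\mathbb{B}_\delta(\bar x)\cap\Lambda;\qquad( * )$$ $\mathrm{sr}'[A,B](\bar x)$ denotes the infimum of all $\kappa\ge0$ for which $( * )$ holds for some $\delta>0$.
   Formalization: ''Subtransversal relative to Λ'' is taken in the form ( * ), tested at points of A∩Λ near x̄; the max form at all points of Λ is equivalent when A⊂Λ but makes the claim false in general (A=B the x-axis, Λ the parabola y=x², S={0}). *)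

(* Defs.v *)
From HB Require Import structures.
From mathcomp Require Import all_boot all_order all_algebra.
From mathcomp Require Import all_classical all_reals all_analysis.
From mathcomp Require Import lra.

Set Implicit Arguments.
Unset Strict Implicit.
Unset Printing Implicit Defensive.

Import Order.TTheory GRing.Theory Num.Theory.
Import numFieldNormedType.Exports.

Local Open Scope classical_set_scope.
Local Open Scope ring_scope.

(* Euclidean spaces: finite-dimensional ([Vector]) real normed spaces whose
   norm comes from an inner product.  Positive definiteness of [inner] follows
   from [normr_inner]. *)
HB.mixin Record isEuclidean (R : realType) E
    of NormedModule R E & Vector R E := {
  inner : E -> E -> R ;
  innerC : forall x y, inner x y = inner y x ;
  innerDl : forall x y z, inner (x + y) z = inner x z + inner y z ;
  innerZl : forall (a : R) x y, inner (a *: x) y = a * inner x y ;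
  normr_inner : forall x, `|x| ^+ 2 = inner x x
}.

#[short(type="euclideanType")]
HB.structure Definition Euclidean (R : realType) :=
  {E of NormedModule R E & Vector R E & isEuclidean R E}.

Section AlternatingProjections.
Context {R : realType} {E : euclideanType R}.
Implicit Types (A B C L S : set E) (x xbar : E) (u : nat -> E).

(* [inf] is real-valued with [inf set0 = 0], so this is the usual distance
   only for nonempty [C]. *)
Definition dist x C : R := inf [set `|x - a| | a in C].

Definition projector C x : set E :=
  [set a | C a /\ forall a', C a' -> `|a - x| <= `|a' - x|].

Definition alternating_projections A B u : Prop :=
  forall k, exists2 b, projector B (u k) b & projector A b (u k.+1).

Definition linearly_monotone S (c : R) u : Prop :=
  forall k, dist (u k.+1) S <= c * dist (u k) S.

Definition subtransversal_const A B L xbar (kappa : R) : Prop :=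
  0 <= kappa /\
  exists2 delta : R, 0 < delta &
    forall x, A x -> ball xbar delta x -> L x ->
      dist x (A `&` B `&` L) <= kappa * dist x B.

(* There is also the variant [subtransversal_max] below, which tests all points
   of [L] near [xbar] instead of only those of [A `&` L].  It is equivalent
   when [A `<=` L] ([subtransversal_maxP]), but strictly stronger in general:
   for A = B = the x-axis and L = the parabola y = x^2 in the plane, the points
   of [L] near 0 violate it although [A `&` L = [set 0]].  In all cases,
   [subtransversal A B L] is [subtransversal_max A B (A `&` L)]. *)
Definition subtransversal A B L xbar : Prop :=
  exists kappa : R, subtransversal_const A B L xbar kappa.

(* The infimum is taken in [\bar R]; it is [+oo] when there is no constant. *)
Definition sr' A B L xbar : \bar R :=
  ereal_inf [set kappa%:E | kappa in subtransversal_const A B L xbar].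

Definition subtransversal_max A B L xbar : Prop :=
  exists2 kappa : R, 0 <= kappa &
  exists2 delta : R, 0 < delta &
    forall x, ball xbar delta x -> L x ->
      dist x (A `&` B `&` L) <= kappa * Num.max (dist x A) (dist x B).

Lemma dist_has_inf x C : C !=set0 -> has_inf [set `|x - a| | a in C].
Proof.
move=> [a Ca]; split; first by exists `|x - a|; exists a.
by exists 0 => _ [b _ <-].
Qed.

Lemma dist_ge0 x C : 0 <= dist x C.
Proof.
have [->|/set0P C0] := eqVneq C set0; first by rewrite /dist image_set0 inf0.
by apply: lb_le_inf => [|_ [b _ <-]//]; have [] := dist_has_inf x C0.
Qed.

Lemma dist_le x a C : C a -> dist x C <= `|x - a|.
Proof.
move=> Ca; apply: ge_inf; last by exists a.
by have [] : has_inf [set `|x - b| | b in C] by apply: dist_has_inf; exists a.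
Qed.

Lemma dist_in x C : C x -> dist x C = 0.
Proof.
move=> Cx; apply/eqP; rewrite eq_le dist_ge0 andbT.
by rewrite (le_trans (dist_le x Cx))// subrr normr0.
Qed.

Lemma dist_triangle x y C : C !=set0 -> dist x C <= `|x - y| + dist y C.
Proof.
move=> C0; rewrite -lerBlDl; apply: lb_le_inf.
  by have [] := dist_has_inf y C0.
move=> _ [a Ca <-]; rewrite lerBlDl (le_trans (dist_le x Ca))//.
by rewrite -(subrKA y) ler_normD.
Qed.

Lemma subtransversalE A B L xbar : A xbar ->
  subtransversal A B L xbar <-> subtransversal_max A B (A `&` L) xbar.
Proof.
rewrite /subtransversal_max.
have -> : A `&` B `&` (A `&` L) = A `&` B `&` L.
  by apply/seteqP; split => x /=; rewrite /setI /=; tauto.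
move=> Axb; split.
  move=> [k [k0 [d d0 H]]]; exists k => //; exists d => // x xd [Ax Lx].
  by rewrite (dist_in Ax) max_r ?dist_ge0//; exact: H.
move=> [k k0 [d d0 H]]; exists k; split => //; exists d => // x Ax xd Lx.
by have := H x xd (conj Ax Lx); rewrite (dist_in Ax) max_r ?dist_ge0.
Qed.

Lemma subtransversal_maxP A B L xbar :
  A `<=` L -> A xbar -> B xbar ->
  subtransversal A B L xbar <-> subtransversal_max A B L xbar.
Proof.
move=> AL Axb Bxb; split; last first.
  move=> [k k0 [d d0 H]]; exists k; split => //; exists d => // x Ax xd Lx.
  by have := H x xd Lx; rewrite (dist_in Ax) max_r ?dist_ge0.
move=> [k [k0 [d d0 H]]]; exists (1 + k + k); first by rewrite !addr_ge0.
exists (d / 2); first by rewrite divr_gt0.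
move=> x; rewrite -ball_normE /= => xd Lx.
set m := Num.max _ _; apply/ler_addgt0Pr => e e0.
have D0 : (A `&` B `&` L) !=set0 by exists xbar; split => //; exact: AL.
have e'0 : 0 < Num.min (d / 2 - `|xbar - x|) (e / (1 + k)).
  by rewrite lt_min subr_gt0 xd divr_gt0// ltr_pwDl.
have [_ [a Aa <-] xa] := inf_adherent e'0
  (dist_has_inf x (ex_intro A xbar Axb)).
move: xa; rewrite -/(dist x A) -ltrBlDl lt_min => /andP[xa1 xa2].
have dxA : dist x A <= `|xbar - x| by rewrite distrC; exact: dist_le.
have ad : ball xbar d a.
  rewrite -ball_normE /= -(subrKA x) (le_lt_trans (ler_normD _ _))//.
  by rewrite [ltRHS]splitr; move: xa1 dxA xd; lra.
rewrite (le_trans (dist_triangle x a D0))//.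
have H1 := H a Aa ad (AL _ Aa).
have H2 : dist a B <= `|x - a| + dist x B.
  by rewrite distrC; apply: dist_triangle; exists xbar.
have H3 : k * dist a B <= k * (`|x - a| + dist x B) by rewrite ler_wpM2l.
have mA : dist x A <= m by rewrite le_max lexx.
have mB : dist x B <= m by rewrite le_max lexx orbT.
have H4 : (1 + k) * `|x - a| <= (1 + k) * dist x A + e.
  rewrite -lerBlDl -mulrBr mulrC -ler_pdivlMr ?ltr_pwDl//; exact: ltW.
have H5 : (1 + k) * dist x A <= (1 + k) * m by rewrite ler_wpM2l// addr_ge0.
have H6 : k * dist x B <= k * m by rewrite ler_wpM2l.
by move: H1 H3 H4 H5 H6; rewrite !mulrDr !mulrDl !mul1r; lra.
Qed.

End AlternatingProjections.

(* Main.v *)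
Require Import Defs.
From mathcomp Require Import all_boot all_order all_algebra.
From mathcomp Require Import all_classical all_reals all_analysis.
From mathcomp Require Import lra.
Import passmx.
Import Order.TTheory GRing.Theory Num.Theory.
Import numFieldNormedType.Exports.
Local Open Scope classical_set_scope.
Local Open Scope ring_scope.

(** The hypothesis speaks of exact alternating projections, so it has content
    only because such sequences exist from every starting point: closed balls
    of a finite-dimensional space are compact ([closed_ball_compact]), hence
    projections onto nonempty closed sets exist ([projector_neq0]).

    Let x_0 in [A `&` L] be close to xbar, run alternating projections
    x_(k+1) in P_A b_k, b_k in P_B x_k from it, and put d = dist x_0 B.  Since
    x_k competes with the nearest point x_(k+1) of A to b_k, both have distance
    at most dist x_k B to b_k.  So the distances to B never increase, and each
    step from x_k to x_(k+1) has length at most 2 d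
    ([alternating_projections_displacement]).  By hypothesis some j < n has
    dist x_(j+n) S <= c * dist x_j S.  Decreasing the distance to S by the
    factor c requires moving by at least (1 - c) * dist x_j S
    ([contracting_move]), whereas n steps move by at most 2 n d; therefore
    dist x_j S <= 2 n d / (1 - c).  As x_j is at most 2 (n - 1) d away from
    x_0,
      dist x_0 S <= (2 (n - 1) + 2 n / (1 - c)) d
                  = 2 (2 n - 1 - c (n - 1)) / (1 - c) * d,
    and n <= n ^ 2 gives the stated constant.  Since S lies in
    [A `&` B `&` L], the distance to that intersection is smaller still. *)

Section FiniteDimension.
Context {R : realType} {V : normedModType R} {n : nat}.
Variable f : {linear 'rV[R]_n -> V}.

Lemma linear_rV_continuous : continuous f.
Proof.
have -> : (f : 'rV[R]_n -> V) =
    (fun v => \sum_(i < n) v ord0 i *: f (delta_mx ord0 i)).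
  apply/funext => v; rewrite {1}(row_sum_delta v) linear_sum.
  by apply: eq_bigr => i _; rewrite linearZ.
apply: continuous_big => [[a b]|i _ v]; first exact: add_continuous.
exact: cvgZr_tmp (@coord_continuous R 1 n ord0 i v).
Qed.

(** The norm of [f v] attains a minimum on the compact unit sphere, which is
    positive because [f] is injective; homogeneity does the rest. *)
Lemma linear_rV_bounded_below : injective f ->
  exists2 m : R, 0 < m & forall v, m * `|v| <= `|f v|.
Proof.
move=> f_inj; pose U := [set v : 'rV[R]_n | `|v| = 1].
have cU : compact U.
  apply: bounded_closed_compact.
    by exists 1; split => // M M1 v /= ->; exact: ltW.
  apply: (preimage_closed _ (@closed_eq _ _)) => v _; exact: norm_continuous.
have normU v : v != 0 -> U (`|v|^-1 *: v).
  by move=> v0; rewrite /U /= normrZ normfV normr_id mulVf// normr_eq0.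
(* The sphere is empty when n = 0. *)
have [U0|/set0P U0] := eqVneq U set0.
  exists 1 => // v; have [->|/normU] := eqVneq v 0.
    by rewrite normr0 mulr0.
  by rewrite U0.
have cf : {within U, continuous (fun v => `|f v|)}.
  apply: continuous_subspaceT => v.
  by apply: continuous_comp;
    [exact: linear_rV_continuous|exact: norm_continuous].
have [u /set_mem Uu umin] := compact_EVT_min U0 cU cf.
exists `|f u|.
  rewrite normr_gt0; apply/eqP => fu0.
  have u0 : u = 0 by apply: f_inj; rewrite fu0 linear0.
  by move: Uu; rewrite /U /= u0 normr0 => /esym/eqP; rewrite oner_eq0.
move=> v; have [->|v0] := eqVneq v 0; first by rewrite normr0 mulr0.
have := umin _ (mem_set (normU _ v0)).
by rewrite linearZ normrZ normfV normr_id mulrC ler_pdivlMr ?normr_gt0.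
Qed.

End FiniteDimension.

Section Projections.
Context {R : realType} {E : euclideanType R}.
Implicit Types (A B C S : set E) (x y a b : E) (u : nat -> E).

(** In the coordinates of a basis, a closed ball becomes a closed bounded set
    of row vectors. *)
Lemma closed_ball_compact x (r : R) : compact (closed_ball_ Num.norm x r).
Proof.
pose f : {linear 'rV[R]_(\dim {: E}) -> E} := vecof (vbasis {: E}).
have basisE := vbasisP {: E}.
have f_inj : injective f by exact: can_inj (vecofK basisE).
have f_surj : f @` setT = setT.
  apply/seteqP; split => // y _; exists (rVof (vbasis {: E}) y) => //.
  exact: rVofK.
rewrite -(image_preimage (closed_ball_ Num.norm x r) f_surj).
apply: continuous_compact.
  by apply: continuous_subspaceT; exact: linear_rV_continuous.
apply: bounded_closed_compact; last first.
  apply: preimage_closed (@closed_closed_ball_ _ _ _ _) => v _.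
  exact: linear_rV_continuous.
have [m m0 mf] := linear_rV_bounded_below f f_inj.
exists ((`|x| + r) / m); split=> [|M /ltW + v /= xv]; first exact: num_real.
apply: le_trans; rewrite ler_pdivlMr// mulrC (le_trans (mf v))//.
by rewrite -[f v](subKr x) (le_trans (ler_normB _ _))// lerD2l.
Qed.

Lemma projector_neq0 C x : closed C -> C !=set0 -> projector C x !=set0.
Proof.
move=> closedC [a0 Ca0]; pose K := closed_ball_ Num.norm x `|x - a0| `&` C.
have cK : compact K := compact_closedI (closed_ball_compact x _) closedC.
have K0 : K !=set0 by exists a0; split; rewrite /closed_ball_ /=.
have cdist : {within K, continuous (fun a => `|x - a|)}.
  apply: continuous_subspaceT => a.
  by apply: cvg_norm; apply: cvgB; [exact: cvg_cst|exact: cvg_id].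
have [a /set_mem[/= axa0 Ca] amin] := compact_EVT_min K0 cK cdist.
exists a; split => // a' Ca'; rewrite ![`|_ - x|]distrC.
have [a'x|/ltW a'x] := leP `|x - a'| `|x - a0|; first exact/amin/mem_set.
exact: le_trans a'x.
Qed.

Lemma alternating_projections_exists A B x :
  closed A -> closed B -> A !=set0 -> B !=set0 ->
  exists2 u, alternating_projections A B u & u 0%N = x.
Proof.
move=> cA cB A0 B0.
have /dependent_choice/(_ x)[u [u0 uS]] : forall y, {z : E |
    exists2 b, projector B y b & projector A b z}.
  move=> y; apply: cid; have [b yb] := projector_neq0 B y cB B0.
  by have [z bz] := projector_neq0 A b cA A0; exists z, b.
by exists u.
Qed.

Lemma projector_dist C x a : projector C x a -> `|a - x| = dist x C.
Proof.
move=> [Ca amin]; apply/eqP; rewrite eq_le andbC distrC dist_le//=.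
apply: lb_le_inf; first by exists `|x - a|, a.
by move=> _ [b Cb <-]; rewrite distrC [leRHS]distrC; exact: amin.
Qed.

Lemma dist_subset x C S : S !=set0 -> S `<=` C -> dist x C <= dist x S.
Proof.
move=> S0 SC; apply: lb_le_inf; first by have [] := dist_has_inf x S0.
by move=> _ [a Sa <-]; exact/dist_le/SC.
Qed.

(** Points whose distances to [S] differ by a factor [c] are at least that
    difference apart, because the distance to [S] is 1-Lipschitz. *)
Lemma contracting_move S (c : R) x y : S !=set0 ->
  dist y S <= c * dist x S -> (1 - c) * dist x S <= `|x - y|.
Proof. by move=> S0 yx; have := dist_triangle x y S0; lra. Qed.

Lemma alternating_projections_in A B u : alternating_projections A B u ->
  A (u 0%N) -> forall k, A (u k).
Proof. by move=> altu Au0 [//|k]; have [b _ []] := altu k. Qed.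

Section Run.
Variables (A B : set E) (u : nat -> E).
Hypotheses (altu : alternating_projections A B u) (Au0 : A (u 0%N)).

(** Projecting [b] onto [A] yields a point no farther from [b] than the
    iterate [u k], which is itself in [A]. *)
Let alternating_step k : exists b,
  [/\ B b, `|b - u k| = dist (u k) B & `|u k.+1 - b| <= dist (u k) B].
Proof.
have [b ub [_ bmin]] := altu k; have buk := projector_dist B (u k) b ub.
exists b; split => //; first by case: ub.
rewrite -buk [leRHS]distrC; apply: bmin.
exact: (alternating_projections_in A B u altu Au0 k).
Qed.

Lemma alternating_projections_dist k : dist (u k) B <= dist (u 0%N) B.
Proof.
elim: k => // k; apply: le_trans; have [b [Bb _]] := alternating_step k.
by apply: le_trans; exact: dist_le.
Qed.

Lemma alternating_projections_displacement i m :
  `|u i - u (i + m)%N| <= 2 * m%:R * dist (u 0%N) B.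
Proof.
elim: m => [|m IH]; first by rewrite addn0 subrr normr0 mulr0 mul0r.
have [b [_ bu ub]] := alternating_step (i + m).
have := alternating_projections_dist (i + m).
have := ler_distD (u (i + m)%N) (u i) (u (i + m.+1)%N).
have := ler_distD b (u (i + m)%N) (u (i + m.+1)%N).
move: ub bu IH; rewrite addnS [`|u _.+1 - b|]distrC [`|b - _|]distrC -natr1.
by lra.
Qed.

End Run.

End Projections.

Theorem theorem4p12 (R : realType) (E : euclideanType R)
    (L A B S : set E) (xbar : E) (n : nat) (c : R)
    (closedL : closed L) (closedA : closed A) (closedB : closed B)
    (Sxbar : S xbar) (subS : S `<=` A `&` B `&` L)
    (n_ge1 : (1 <= n)%N) (c_ge0 : 0 <= c) (c_lt1 : c < 1)
    (linmono : exists2 rho : R, 0 < rho &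
      forall x : nat -> E,
        alternating_projections A B x ->
        (A `&` L) (x 0%N) -> `|x 0%N - xbar| < rho ->
        exists2 j : nat, (j < n)%N &
          (forall k, L (x (j + n * k)%N)) /\
          linearly_monotone S c (fun k => x (j + n * k)%N)) :
  subtransversal A B L xbar /\
  (sr' A B L xbar <=
     (2 * (2 * n%:R ^+ 2 - 1 - c * (n%:R - 1)) / (1 - c))%:E)%E.
Proof.
set kappa := 2 * _ / _.
suff kappaP : subtransversal_const A B L xbar kappa.
  by split; [exists kappa|apply: ereal_inf_lbound; exists kappa].
have [rho rho0 mono] := linmono.
have c1 : 0 < 1 - c by rewrite subr_gt0.
have n1 : 1 <= n%:R :> R by rewrite ler1n.
have nn : n%:R <= n%:R ^+ 2 :> R by rewrite ler_eXnr.
have cn : c * (n%:R - 1) <= n%:R - 1 by rewrite ler_piMl ?subr_ge0// ltW.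
split; first by rewrite divr_ge0 ?mulr_ge0 ?(ltW c1)//; lra.
exists rho => // x Ax xrho Lx.
have S0 : S !=set0 by exists xbar.
have [[Axbar Bxbar] _] := subS _ Sxbar.
have [u altu u0] := alternating_projections_exists A B x closedA closedB
  (ex_intro A xbar Axbar) (ex_intro B xbar Bxbar).
subst x.
have [||j jn [_ /(_ 0%N)]] := mono u altu; first by split.
  by rewrite distrC; move: xrho; rewrite -ball_normE.
rewrite muln0 addn0 muln1 => /(contracting_move S c _ _ S0) far.
have d0 := dist_ge0 (u 0%N) B; set d := dist (u 0%N) B in d0 *.
have movej := alternating_projections_displacement A B u altu Ax 0 j.
have moven := alternating_projections_displacement A B u altu Ax j n.
rewrite add0n -/d in movej moven.
have jn1 : j%:R * d <= (n%:R - 1) * d.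
  by rewrite ler_wpM2r// lerBrDr natr1 ler_nat.
have near0 : dist (u 0%N) S <= 2 * ((n%:R - 1) * d) + dist (u j) S.
  by have := dist_triangle (u 0%N) (u j) S0; move: movej jn1; lra.
rewrite (le_trans (dist_subset _ _ _ S0 subS))//.
rewrite /kappa mulrAC ler_pdivlMr// mulrC.
have := ler_wpM2l (ltW c1) near0; have := ler_wpM2r d0 nn.
by move: far moven; lra.
Qed.
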